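(* Let $n\ge1$, $\delta>0$ and $\beta<n+2$. Let $S\in\mathbb{R}$, $\mathbf b\in\mathcal H^S(\mathbf T^n)$, and for $t\ge0$ define $$\mathbf U(t)=\widehat{\mathbf b}_0\frac{t^2}{2}+\sum_{0\ne k\in\mathbb{Z}^n}\left[\cos(\sqrt{-M_k}\,t)-I\right]M_k^{-1}\widehat{\mathbf b}_ke^{ik\cdot x}.$$ Then for any $t\ge0$, $\mathbf U(t)\in\mathcal H^s(\mathbf T^n)$, where $s=S+\max\{0,\beta-n\}$.
   Context: Torus and spaces: $\mathbf T^n=\prod_{i=1}^n[0,2\pi]$ with periodic identification; a periodic vector distribution $\mathbf g$ is written $\mathbf g=\sum_{k\in\mathbb{Z}^n}\widehat{\mathbf g}_k e^{ik\cdot x}$ with Fourier coefficients $\widehat{\mathbf g}_k\in\mathbb{C}^n$. For $q\in\mathbb{R}$, $\mathcal H^q(\mathbf T^n)$ is the space of periodic vector distributions with $\|\mathbf g\|^2_{\mathcal H^q}=\sum_k(1+\|k\|^2)^q\|\widehat{\mathbf g}_k\|^2<\infty$. Multipliers: with ${}_pF_q(a_1,\dots,a_p;b_1,\dots,b_q;x)=\sum_{m\ge0}\frac{(a_1)_m\cdots(a_p)_m}{(b_1)_m\cdots(b_q)_m}\frac{x^m}{m!}$, where $(a)_m=a(a+1)\cdots(a+m-1)$, set for $\nu\in\mathbb{R}^n$ $$\lambda_1(\nu)=-\|\nu\|^2\Big(3\mu\,{}_3F_4\big(1,\tfrac52,\tfrac{n+2-\beta}{2};2,\tfrac32,\tfrac{n+4}{2},\tfrac{n+4-\beta}{2};-\tfrac14\|\nu\|^2\delta^2\big)+(\lambda^*-\mu)\,{}_1F_2\big(\tfrac{n+2-\beta}{2};\tfrac{n+2}{2},\tfrac{n+4-\beta}{2};-\tfrac14\|\nu\|^2\delta^2\big)^2\Big),$$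 $$\lambda_2(\nu)=-\mu\|\nu\|^2\,{}_2F_3\big(1,\tfrac{n+2-\beta}{2};2,\tfrac{n+4}{2},\tfrac{n+4-\beta}{2};-\tfrac14\|\nu\|^2\delta^2\big).$$ For $k\in\mathbb{Z}^n\setminus\{0\}$, $M_k$ is the real symmetric $n\times n$ matrix with $M_kk=\lambda_1(k)k$ and $M_kw=\lambda_2(k)w$ for $w\perp k$ (the Fourier multiplier of the linear state-based peridynamic operator). $\sqrt{-M_k}$ and $\cos(\sqrt{-M_k}t)$ are defined by functional calculus: same eigenvectors, with eigenvalues $\sqrt{-\lambda_i(k)}$ and $\cos(\sqrt{-\lambda_i(k)}t)$. $I$ is the identity matrix. Standing assumption: the Lamé parameters satisfy $\mu>0$ and $\lambda^*\in\mathbb{R}$ is such that $\lambda_1(\nu)<0$ for all $\nu\ne0$ (and $\lambda_2(\nu)<0$ for all $\nu\neq0$). *)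

(* Defs.v *)
From HB Require Import structures.
From mathcomp Require Import all_boot all_order all_algebra.
From mathcomp Require Import all_classical all_reals all_analysis.
From mathcomp Require Export complex.

Set Implicit Arguments.
Unset Strict Implicit.
Unset Printing Implicit Defensive.
Import Order.TTheory GRing.Theory Num.Theory.
Import numFieldNormedType.Exports.

Local Open Scope classical_set_scope.
Local Open Scope ring_scope.
Local Open Scope complex_scope.

(* The library norm `|v| of a vector is the max norm, hence the explicit
   Euclidean ones. *)
Definition sqnorm (R : realType) n (v : 'cV[R]_n) : R := \sum_i v i 0 ^+ 2.

Definition enorm (R : realType) n (v : 'cV[R]_n) : R := Num.sqrt (sqnorm v).

Definition sqnormC (R : realType) n (v : 'cV[R[i]]_n) : R :=
  \sum_i (complex.Re (v i 0) ^+ 2 + complex.Im (v i 0) ^+ 2).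

Definition enormC (R : realType) n (v : 'cV[R[i]]_n) : R :=
  Num.sqrt (sqnormC v).

Definition freq (R : realType) n (k : 'cV[int]_n) : 'cV[R]_n :=
  map_mx intr k.

(* A periodic vector distribution sum_k g_k e^{i k.x} is given by its family of
   Fourier coefficients; the families that arise are exactly those of at most
   polynomial growth in k. *)
Definition periodic_distribution (R : realType) n
    (g : 'cV[int]_n -> 'cV[R[i]]_n) : Prop :=
  exists (A : R) (N : nat),
    forall k, enormC (g k) <= A * (1 + enorm (freq R k)) ^+ N.

Definition sobolev (R : realType) n (q : R) :
    set ('cV[int]_n -> 'cV[R[i]]_n) :=
  [set g | periodic_distribution g /\
    (\esum_(k in [set: 'cV[int]_n])
       ((1 + sqnorm (freq R k)) `^ q * sqnormC (g k))%:E < +oo)%E].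

Definition pochhammer (R : realType) (a : R) (m : nat) : R :=
  \prod_(i < m) (a + i%:R).

(* Meaningful when the series converges, which is the case for every x when
   size a <= size b and no entry of b is a nonpositive integer. *)
Definition hypergeom (R : realType) (a b : seq R) (x : R) : R :=
  limn (series (fun m : nat =>
    (\prod_(c <- a) pochhammer c m) / (\prod_(c <- b) pochhammer c m)
      * (x ^+ m / m`!%:R))).

Definition lambda1 (R : realType) n (delta mu lam beta : R) (nu : 'cV[R]_n)
    : R :=
  let x := - (1 / 4) * (sqnorm nu * delta ^+ 2) in
  - sqnorm nu *
    (3 * mu * hypergeom [:: 1; 5 / 2; (n%:R + 2 - beta) / 2]
                [:: 2; 3 / 2; (n%:R + 4) / 2; (n%:R + 4 - beta) / 2] x
     + (lam - mu) * hypergeom [:: (n%:R + 2 - beta) / 2]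
                [:: (n%:R + 2) / 2; (n%:R + 4 - beta) / 2] x ^+ 2).

Definition lambda2 (R : realType) n (delta mu beta : R) (nu : 'cV[R]_n) : R :=
  let x := - (1 / 4) * (sqnorm nu * delta ^+ 2) in
  - mu * sqnorm nu *
    hypergeom [:: 1; (n%:R + 2 - beta) / 2]
              [:: 2; (n%:R + 4) / 2; (n%:R + 4 - beta) / 2] x.

Definition axis_proj (R : realType) n (v : 'cV[R]_n) : 'M[R]_n :=
  (sqnorm v)^-1 *: (v *m v^T).

(* For v != 0, the matrix acting as a on the line of v and as b on its
   orthogonal complement; see axis_mx_eigen, axis_mx_perp, axis_mx_unique. *)
Definition axis_mx (R : realType) n (v : 'cV[R]_n) (a b : R) : 'M[R]_n :=
  a *: axis_proj v + b *: (1%:M - axis_proj v).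

Definition multiplier (R : realType) n (delta mu lam beta : R)
    (k : 'cV[int]_n) : 'M[R]_n :=
  axis_mx (freq R k) (lambda1 delta mu lam beta (freq R k))
                     (lambda2 delta mu beta (freq R k)).

(* Functional calculus f(M_k); see multiplier_funP. *)
Definition multiplier_fun (R : realType) n (delta mu lam beta : R)
    (f : R -> R) (k : 'cV[int]_n) : 'M[R]_n :=
  axis_mx (freq R k) (f (lambda1 delta mu lam beta (freq R k)))
                     (f (lambda2 delta mu beta (freq R k))).

Definition cos_sqrt_multiplier (R : realType) n (delta mu lam beta t : R)
    (k : 'cV[int]_n) : 'M[R]_n :=
  multiplier_fun delta mu lam beta (fun l => cos (Num.sqrt (- l) * t)) k.

(* Fourier coefficients of U(t). *)
Definition peridynamic_sol (R : realType) n (delta mu lam beta : R)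
    (b : 'cV[int]_n -> 'cV[R[i]]_n) (t : R) (k : 'cV[int]_n) : 'cV[R[i]]_n :=
  if k == 0 then (t ^+ 2 / 2)%:C *: b 0
  else map_mx (real_complex R)
         ((cos_sqrt_multiplier delta mu lam beta t k - 1%:M)
            *m invmx (multiplier delta mu lam beta k)) *m b k.

Lemma mul_trmx_sqnorm (R : realType) n (v : 'cV[R]_n) :
  v^T *m v = (sqnorm v)%:M.
Proof.
apply/matrixP => i j; rewrite !ord1 !mxE /sqnorm mulr1n.
by apply: eq_bigr => l _; rewrite !mxE expr2.
Qed.

Lemma sqnorm_eq0 (R : realType) n (v : 'cV[R]_n) : (sqnorm v == 0) = (v == 0).
Proof.
apply/idP/eqP; last first.
  by move=> ->; rewrite /sqnorm big1// => i _; rewrite mxE expr0n.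
move=> /eqP h; apply/matrixP => i j; rewrite ord1 mxE.
have /(_ i isT)/eqP := psumr_eq0P (fun i _ => sqr_ge0 (v i 0)) h.
by rewrite sqrf_eq0 => /eqP.
Qed.

Lemma freq_eq0 (R : realType) n (k : 'cV[int]_n) : (freq R k == 0) = (k == 0).
Proof.
apply/eqP/eqP => [/matrixP h|->]; last first.
  by apply/matrixP => i j; rewrite !mxE.
apply/matrixP => i j; have := h i j; rewrite !mxE => /eqP.
by rewrite intr_eq0 => /eqP.
Qed.

Lemma axis_proj_id (R : realType) n (v : 'cV[R]_n) :
  v != 0 -> axis_proj v *m v = v.
Proof.
move=> v0; rewrite /axis_proj -scalemxAl -mulmxA mul_trmx_sqnorm.
by rewrite mul_mx_scalar scalerA mulVf ?scale1r// sqnorm_eq0.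
Qed.

Lemma axis_proj_idem (R : realType) n (v : 'cV[R]_n) :
  v != 0 -> axis_proj v *m axis_proj v = axis_proj v.
Proof.
move=> v0; rewrite [X in _ *m X]/axis_proj -[LHS]scalemxAr mulmxA.
by rewrite axis_proj_id.
Qed.

Lemma axis_proj_perp (R : realType) n (v w : 'cV[R]_n) :
  v^T *m w = 0 -> axis_proj v *m w = 0.
Proof. by move=> vw; rewrite -scalemxAl -mulmxA vw mulmx0 scaler0. Qed.

Lemma axis_mxE (R : realType) n (v w : 'cV[R]_n) (a b : R) :
  axis_mx v a b *m w =
  a *: (axis_proj v *m w) + b *: (w - axis_proj v *m w).
Proof.
rewrite /axis_mx mulmxDl -[in LHS]scalemxAl; congr (_ + _).
by rewrite -scalemxAl mulmxBl mul1mx.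
Qed.

Lemma axis_mx_sym (R : realType) n (v : 'cV[R]_n) (a b : R) :
  (axis_mx v a b)^T = axis_mx v a b.
Proof.
have sP : (axis_proj v)^T = axis_proj v.
  by rewrite /axis_proj linearZ /= trmx_mul trmxK.
have sQ : (1%:M - axis_proj v)^T = 1%:M - axis_proj v.
  by rewrite linearB /= trmx1 sP.
have sZ c (A : 'M[R]_n) : (c *: A)^T = c *: A^T by rewrite linearZ.
by rewrite /axis_mx linearD /= (sZ a) (sZ b) sP sQ.
Qed.

Lemma axis_mx_eigen (R : realType) n (v : 'cV[R]_n) (a b : R) :
  v != 0 -> axis_mx v a b *m v = a *: v.
Proof. by move=> v0; rewrite axis_mxE axis_proj_id// subrr scaler0 addr0. Qed.

Lemma axis_mx_perp (R : realType) n (v w : 'cV[R]_n) (a b : R) :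
  v^T *m w = 0 -> axis_mx v a b *m w = b *: w.
Proof. by move=> vw; rewrite axis_mxE axis_proj_perp// scaler0 add0r subr0. Qed.

Lemma perp_sub_axis_proj (R : realType) n (v w : 'cV[R]_n) :
  v != 0 -> v^T *m (w - axis_proj v *m w) = 0.
Proof.
move=> v0; rewrite mulmxBr mulmxA /axis_proj -scalemxAr mulmxA.
rewrite mul_trmx_sqnorm mul_scalar_mx scalerA mulVf ?sqnorm_eq0//.
by rewrite scale1r subrr.
Qed.

Lemma axis_mx_unique (R : realType) n (v : 'cV[R]_n) (a b : R) (A : 'M[R]_n) :
  v != 0 -> A *m v = a *: v ->
  (forall w : 'cV[R]_n, v^T *m w = 0 -> A *m w = b *: w) ->
  A = axis_mx v a b.
Proof.
move=> v0 Av Aw.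
have E (w : 'cV[R]_n) : A *m w = axis_mx v a b *m w.
  rewrite axis_mxE -(Aw _ (perp_sub_axis_proj w v0)) mulmxBr.
  have -> : a *: (axis_proj v *m w) = A *m (axis_proj v *m w).
    by rewrite mulmxA /axis_proj -scalemxAr mulmxA Av -!scalemxAl scalerA
      mulrC -scalerA.
  by rewrite addrC subrK.
rewrite -[LHS]mulmx1 -[RHS]mulmx1; apply/matrixP => i j.
have /matrixP /(_ i 0) := E (col j 1%:M).
by rewrite !colE !mulmxA -!colE !mxE.
Qed.

Lemma multiplier_funP (R : realType) n (delta mu lam beta : R) (f : R -> R)
    (k : 'cV[int]_n) (a : R) (w : 'cV[R]_n) :
  k != 0 -> multiplier delta mu lam beta k *m w = a *: w ->
  multiplier_fun delta mu lam beta f k *m w = f a *: w.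
Proof.
rewrite -(freq_eq0 R) /multiplier /multiplier_fun.
set v := freq R k; set l1 := lambda1 _ _ _ _ _; set l2 := lambda2 _ _ _ _.
move=> v0; rewrite !axis_mxE.
set p := axis_proj v *m w; set q := w - p => H.
have wE : w = p + q by rewrite /q addrC subrK.
have Pp : axis_proj v *m p = p.
  by rewrite /p mulmxA axis_proj_idem.
have Pq : axis_proj v *m q = 0.
  by rewrite /q mulmxBr Pp subrr.
have {}H : l1 *: p + l2 *: q = a *: p + a *: q by rewrite H {1}wE scalerDr.
have Hp : l1 *: p = a *: p.
  have := congr1 (mulmx (axis_proj v)) H.
  by rewrite !mulmxDr -!scalemxAr Pp Pq !scaler0 !addr0.
have Hq : l2 *: q = a *: q by move: H; rewrite Hp => /addrI.
have F (l : R) (u : 'cV[R]_n) : l *: u = a *: u -> f l *: u = f a *: u.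
  move=> /eqP; rewrite -subr_eq0 -scalerBl scaler_eq0 subr_eq0.
  by case/orP => /eqP ->; rewrite ?scaler0.
by rewrite (F _ _ Hp) (F _ _ Hq) -scalerDr -wE.
Qed.

(* Main.v *)
Require Import Defs.
From mathcomp Require Import all_boot all_order all_algebra.
From mathcomp Require Import all_classical all_reals all_analysis.
From mathcomp Require Import ring lra.
Import Order.TTheory GRing.Theory Num.Theory.
Import numFieldNormedType.Exports.
Set Implicit Arguments.
Unset Strict Implicit.
Unset Printing Implicit Defensive.
Local Open Scope classical_set_scope.
Local Open Scope ring_scope.

(** Everything rests on lower bounds for the eigenvalues: if
    [- lambda_i k >= c (1 + |k|^2)^(s/2)] for all [k != 0], where
    [s = max(0, beta - n)], then the matrix [(cos (sqrt (- M_k) t) - I) M_k^-1],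
    which has the same eigenvectors as [M_k] and eigenvalues of modulus at most
    [2 / |lambda_i k|], multiplies the k-th Fourier coefficient by
    [O((1 + |k|^2)^(-s/2))], which is a gain of [s] derivatives
    ([sobolev_smoothing], [peridynamic_sol_le]).

    The eigenvalue bounds are obtained from ordinary differential equations
    rather than from the asymptotics of the hypergeometric functions. Put
    [x = |k|^2 delta^2 / 4], [b = (n + 2) / 2] and [r = (n - beta) / 2 > -1], so
    that [s/2 = max(0, -r)]. All three hypergeometric series are expressed by
    the Bessel type function [bessel b x = 0F1(; b; -x)] and by the weighted
    mean [gap_mean b r x = x^(-r) * int_0^x y^(r-1) (1 - bessel b y) dy],
    through comparison of coefficients ([hypergeom23], [hypergeom34],
    [hypergeom12]):
    - [- lambda2] is a positive multiple of [gap_mean b r x];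
    - [- lambda1] is a positive multiple of
      [axial b r x = (1 - 2 r) gap_mean b r x + 2 (1 - bessel b x)] plus a
      multiple of unknown sign of [x * (bessel_mean b r x)^2].

    From the equation [x y'' + b y' + y = 0] of [bessel b] two Lyapunov
    functions give the decay of the energy [y^2 + x y'^2] like [1 / x]
    ([energy_decay]). Hence [1 - bessel b] tends to [1], and the first order
    equation [x h' + r h = 1 - bessel b] of [h = gap_mean b r], compared with
    explicit super- and subsolutions, yields:
    - [h >= c x^(-r)] for [r < 0] and [h >= c] for [r >= 0]
      ([gap_mean_lower]);
    - [limsup h <= 1/r] for [r > 0], which makes [axial] bounded below also
      where its coefficient [1 - 2 r] is negative: its lower limit is at least
      [(1 - 2 r) / r + 2 = 1 / r] ([axial_lower]);
    - [h <= C x^q] for every [q > max(0, -r)] ([gap_mean_upper]), from which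
      [x * (bessel_mean b r x)^2 = o(x^max(0, -r))] ([bessel_mean_small]), so
      that the term of unknown sign is absorbed.

    These bounds hold for large [|k|]. The eigenvalues depend on [k] through the
    natural number [|k|^2] only, hence take finitely many values for the other
    nonzero [k], and each of these is negative by assumption
    ([freq_lower_bound]). *)

(** * Sums of power series with factorially decreasing coefficients *)

Definition psum (R : realType) (c : nat -> R) (x : R) : R :=
  limn (pseries c x).

(** A majorant by the exponential series: it makes the power series converge
    everywhere and is stable under termwise differentiation. *)
Definition factorially_bounded (R : realType) (c : nat -> R) : Prop :=
  exists M : R, forall m, `|c m| <= M / m`!%:R.

Lemma factorially_bounded_cvg (R : realType) (c : nat -> R) (x : R) :
  factorially_bounded c -> cvgn (pseries c x).
Proof.
move=> [M cM]; apply: normed_cvg.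
have := is_cvg_seriesZ (k := M) (is_cvg_series_exp_coeff `|x|).
apply: series_le_cvg => m /=.
- exact: normr_ge0.
- apply: mulr_ge0; last by apply: divr_ge0; rewrite ?exprn_ge0.
  have := le_trans (normr_ge0 _) (cM 0%N).
  by rewrite fact0 divr1.
- rewrite normrM normrX [leRHS](_ : _ = M / m`!%:R * `|x| ^+ m).
    by rewrite ler_wpM2r// exprn_ge0.
  by rewrite /exp_coeff/= [LHS]mulrCA mulrC mulrAC.
Qed.

Lemma factorially_bounded_diffs (R : realType) (c : nat -> R) :
  factorially_bounded c -> factorially_bounded (pseries_diffs c).
Proof.
move=> [M cM]; exists M => m; rewrite /pseries_diffs normrM normr_nat.
have := ler_wpM2l (ler0n R m.+1) (cM m.+1) => /le_trans; apply.
rewrite factS natrM invfM mulrCA mulVKf//; lra.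
Qed.

Lemma psum_cvg (R : realType) (c : nat -> R) (x : R) :
  factorially_bounded c -> pseries c x @ \oo --> psum c x.
Proof. exact: factorially_bounded_cvg. Qed.

Lemma is_derive_psum (R : realType) (c : nat -> R) (x : R) :
  factorially_bounded c ->
  is_derive x 1 (psum c) (psum (pseries_diffs c) x).
Proof.
move=> cM; have dM := factorially_bounded_diffs cM.
have ddM := factorially_bounded_diffs dM.
apply: (@pseries_snd_diffs _ _ (`|x| + 1)); try exact: factorially_bounded_cvg.
by rewrite [ltRHS]ger0_norm ?ltrDl// addr_ge0.
Qed.

(** The operator [x d/dx] multiplies the m-th coefficient by [m]. Written with
    it, the differential equations below become identities between coefficients,
    without any shift of index. *)
Lemma cvg_pseries_euler (R : realType) (c : nat -> R) (x : R) :
  factorially_bounded c ->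
  pseries (fun m => m%:R * c m) x @ \oo --> x * psum (pseries_diffs c) x.
Proof.
move=> cM.
have h := pseries_diffs_equiv
  (factorially_bounded_cvg (x := x) (factorially_bounded_diffs cM)).
apply: cvg_trans (cvgM (cvg_cst x) h); apply: near_eq_cvg; near=> N.
rewrite /pseries/= /series/= mulr_sumr; apply: eq_bigr => -[|m] _ /=.
  by rewrite !mul0r mulr0.
by rewrite exprS mulrCA.
Unshelve. all: by end_near. Qed.

Lemma cvg_pseriesD (R : realType) (c d : nat -> R) (x k l : R) :
  pseries c x @ \oo --> k -> pseries d x @ \oo --> l ->
  pseries (fun m => c m + d m) x @ \oo --> k + l.
Proof.
move=> hc hd; apply: cvg_trans (cvgD hc hd).
apply: near_eq_cvg; near=> N.
rewrite /pseries/= /series/=; under [RHS]eq_bigr do rewrite mulrDl.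
by rewrite big_split.
Unshelve. all: by end_near. Qed.

Lemma cvg_pseriesZ (R : realType) (c : nat -> R) (x k a : R) :
  pseries c x @ \oo --> k ->
  pseries (fun m => a * c m) x @ \oo --> a * k.
Proof.
move=> hc; apply: cvg_trans (cvgM (cvg_cst a) hc).
apply: near_eq_cvg; near=> N.
by rewrite /pseries/= /series/= mulr_sumr; apply: eq_bigr => m _; rewrite mulrA.
Unshelve. all: by end_near. Qed.

Lemma cvg_pseries_const (R : realType) (x a : R) :
  pseries (fun m => if m == 0%N then a else 0) x @ \oo --> a.
Proof.
apply: cvg_near_cst; near=> N.
have N0 : (0 < N)%N by near: N; exists 1%N.
rewrite /pseries/= /series/= -(prednK N0) big_nat_recl//= expr0 mulr1.
by rewrite big1 ?addr0// => m _; rewrite mul0r.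
Unshelve. all: by end_near. Qed.

Lemma cvg_pseries_unique (R : realType) (c d : nat -> R) (x k l : R) :
  c =1 d -> pseries c x @ \oo --> k -> pseries d x @ \oo --> l -> k = l.
Proof.
move=> /funext -> hk hl; exact: (cvg_unique _ hk hl).
Qed.

Lemma psum_at0 (R : realType) (c : nat -> R) : psum c 0 = c 0%N.
Proof.
apply: (cvg_lim (@norm_hausdorff _ _)); apply: cvg_near_cst; near=> N.
have N0 : (0 < N)%N by near: N; exists 1%N.
rewrite /pseries/= /series/= -(prednK N0) big_nat_recl//= expr0 mulr1.
by rewrite big1 ?addr0// => m _; rewrite exprS mul0r mulr0.
Unshelve. all: by end_near. Qed.

(** * The Bessel type function 0F1(; b; -x) and its weighted mean *)

Lemma is_derive_le0_nonincreasing (R : realType) (f df : R -> R) (a : R) :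
  (forall x, a <= x -> is_derive x 1 f (df x)) ->
  (forall x, a <= x -> df x <= 0) ->
  forall x y, a <= x -> x <= y -> f y <= f x.
Proof.
move=> fdf df0 x y ax xy.
have [||c] := MVT_segment (f := f) (df := df) xy.
- by move=> z; rewrite in_itv/= => /andP[xz _]; apply: fdf; lra.
- apply: derivable_within_continuous => z; rewrite in_itv/= => /andP[xz _].
  by have [] := fdf z (le_trans ax xz).
rewrite in_itv/= => /andP[xc _] E; rewrite -subr_le0 E.
by rewrite mulr_le0_ge0 ?subr_ge0// df0//; lra.
Qed.

Lemma pochhammer_ge1 (R : realType) (b : R) m : 1 <= b -> 1 <= pochhammer b m.
Proof.
move=> b1; rewrite /pochhammer; elim: m => [|m IH]; first by rewrite big_ord0.
rewrite big_ord_recr/= -[leLHS]mulr1; apply: ler_pM => //.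
by rewrite (le_trans b1)// lerDl.
Qed.

Lemma pochhammerS (R : realType) (b : R) m :
  pochhammer b m.+1 = pochhammer b m * (b + m%:R).
Proof. by rewrite /pochhammer big_ord_recr. Qed.

Definition bessel_coef (R : realType) (b : R) (m : nat) : R :=
  (- 1) ^+ m / (pochhammer b m * m`!%:R).

Definition bessel (R : realType) (b : R) : R -> R := psum (bessel_coef b).

Definition dbessel (R : realType) (b : R) : R -> R :=
  psum (pseries_diffs (bessel_coef b)).

(** Coefficients of [x^(-r) * int_0^x y^(r-1) (1 - bessel b y) dy], integrated
    termwise; the constant term of [1 - bessel b] vanishes, so that the integral
    converges for [r > -1]. *)
Definition gap_mean_coef (R : realType) (b r : R) (m : nat) : R :=
  if m == 0%N then 0 else - (bessel_coef b m / (r + m%:R)).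

Definition gap_mean (R : realType) (b r : R) : R -> R :=
  psum (gap_mean_coef b r).

Lemma bessel_coef_bounded (R : realType) (b : R) :
  3 / 2 <= b -> factorially_bounded (bessel_coef b).
Proof.
move=> b_ge; exists 1 => m.
rewrite /bessel_coef normrM normrX normrN1 expr1n !mul1r.
have P1 : 1 <= pochhammer b m by apply: pochhammer_ge1; lra.
rewrite normfV ger0_norm ?mulr_ge0//; last lra.
rewrite lef_pV2 ?posrE ?mulr_gt0 ?ltr0n ?fact_gt0//; last lra.
by rewrite ler_peMl.
Qed.

Lemma addr1_le_addrn (R : realType) (r : R) m :
  m != 0%N -> r + 1 <= r + m%:R.
Proof. by rewrite -lt0n => m0; rewrite lerD2l ler1n. Qed.

Lemma gap_mean_coef_bounded (R : realType) (b r : R) :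
  3 / 2 <= b -> - 1 < r -> factorially_bounded (gap_mean_coef b r).
Proof.
move=> b_ge r_gt; have [M cM] := bessel_coef_bounded b_ge.
exists (M / (r + 1)) => m; rewrite /gap_mean_coef.
have M0 : 0 <= M.
  by have := le_trans (normr_ge0 _) (cM 0%N); rewrite fact0 divr1.
case: eqVneq => [_|m0]; first by rewrite normr0 !divr_ge0//; lra.
have := addr1_le_addrn r m0 => mr; rewrite normrN normrM normfV.
rewrite (ger0_norm (x := r + _)); last lra.
rewrite mulrAC; apply: ler_pM => //; first by rewrite invr_ge0; lra.
by rewrite lef_pV2 ?posrE; lra.
Qed.

Lemma is_derive_bessel (R : realType) (b x : R) :
  3 / 2 <= b -> is_derive x 1 (bessel b) (dbessel b x).
Proof. by move=> ?; exact/is_derive_psum/bessel_coef_bounded. Qed.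

Lemma bessel_coefS (R : realType) (b : R) m :
  3 / 2 <= b ->
  (b + m%:R) * (m.+1%:R * bessel_coef b m.+1) = - bessel_coef b m.
Proof.
move=> b_ge; rewrite /bessel_coef pochhammerS factS natrM exprS.
have P1 : 1 <= pochhammer b m by apply: pochhammer_ge1; lra.
have m0 : 0 <= m%:R :> R by [].
have f0 : (m`!%:R : R) != 0 by rewrite pnatr_eq0 -lt0n fact_gt0.
have m1 : (m.+1%:R : R) != 0 by [].
by field; rewrite f0 !lt0r_neq0//; lra.
Qed.

(** The second derivative enters the sequel through the Bessel equation
    [x y'' + b y' + y = 0] alone, hence the existential form. *)
Lemma is_derive_dbessel (R : realType) (b x : R) :
  3 / 2 <= b ->
  exists2 ddbessel : R, is_derive x 1 (dbessel b) ddbessel &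
    x * ddbessel = - (b * dbessel b x) - bessel b x.
Proof.
move=> b_ge; have cB := bessel_coef_bounded b_ge.
have dB := factorially_bounded_diffs cB.
eexists; first exact/is_derive_psum.
apply/eqP; rewrite -subr_eq0; apply/eqP.
have h := cvg_pseries_euler (x := x) dB.
have := cvg_pseriesD (cvg_pseriesD h
  (cvg_pseriesZ (a := b) (psum_cvg (x := x) dB)))
  (psum_cvg (x := x) cB).
move=> /(cvg_pseries_unique _) E.
rewrite opprB opprK addrCA.
have <- := E _ 0 _ (@cvg_pseries_const R x 0).
  by rewrite /bessel/dbessel; ring.
move=> m; rewrite /pseries_diffs -mulrDl (addrC m%:R) bessel_coefS// addNr.
by case: eqP.
Qed.

(** The equation [x h' + r h = 1 - bessel b] is what differentiating
    [x^r h = int_0^x y^(r-1) (1 - bessel b y) dy] gives. *)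
Lemma is_derive_gap_mean (R : realType) (b r x : R) :
  3 / 2 <= b -> - 1 < r ->
  exists2 dgap_mean : R, is_derive x 1 (gap_mean b r) dgap_mean &
    x * dgap_mean = 1 - bessel b x - r * gap_mean b r x.
Proof.
move=> b_ge r_gt; have cB := bessel_coef_bounded b_ge.
have mB := gap_mean_coef_bounded b_ge r_gt.
eexists; first exact/is_derive_psum/mB.
have h := cvg_pseries_euler (x := x) mB.
have := cvg_pseriesD (cvg_pseriesD h
  (cvg_pseriesZ (a := r) (psum_cvg (x := x) mB)))
  (psum_cvg (x := x) cB).
move=> /(cvg_pseries_unique _) E.
have <- := E _ 1 _ (@cvg_pseries_const R x 1).
  by rewrite /bessel/gap_mean; ring.
move=> m; rewrite -mulrDl /gap_mean_coef; case: eqVneq => [->|m0].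
  by rewrite mulr0 add0r /bessel_coef /pochhammer big_ord0 fact0 expr0; field.
have mr := addr1_le_addrn r m0.
by field; rewrite addrC lt0r_neq0//; lra.
Qed.

Lemma bessel0 (R : realType) (b : R) : bessel b 0 = 1.
Proof.
rewrite /bessel psum_at0 /bessel_coef /pochhammer big_ord0 fact0 expr0.
by field.
Qed.

(** * Decay of the energy *)

Definition energy (R : realType) (b : R) : R -> R :=
  bessel b ^+ 2 + id * dbessel b ^+ 2.

Lemma energyE (R : realType) (b x : R) :
  energy b x = bessel b x ^+ 2 + x * dbessel b x ^+ 2.
Proof. by rewrite /energy !fctE. Qed.

(** The Bessel equation turns the derivative of the energy into the damping term
    alone. *)
Lemma is_derive_energy (R : realType) (b x : R) : 3 / 2 <= b ->
  is_derive x 1 (energy b) ((1 - 2 * b) * dbessel b x ^+ 2).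
Proof.
move=> b_ge; have [d2 hd2 e2] := is_derive_dbessel x b_ge.
have h := is_derive_bessel x b_ge.
apply: is_derive_eq; rewrite /GRing.scale/= !fctE; ring: e2.
Qed.

Lemma energy_le1 (R : realType) (b x : R) : 3 / 2 <= b -> 0 <= x ->
  energy b x <= 1.
Proof.
move=> b_ge x0; have -> : 1 = energy b 0.
  by rewrite energyE bessel0 mul0r addr0 expr1n.
apply: (@is_derive_le0_nonincreasing _ _ _ 0) x0 => //.
  by move=> y _; exact: is_derive_energy.
move=> y _ /=; rewrite mulr_le0_ge0 ?sqr_ge0//; lra.
Qed.

(** Besides the energy [E], the quantity
    [2 x (E + y y') + (b - 1) y^2], with [y = bessel b], is nonincreasing: the
    Bessel equation cancels all terms of its derivative except
    [2 (3 - 2 b) x y'^2], which has a sign since [b >= 3/2]. Its value at [0] is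
    [b - 1], and [|y y'| <= E / 2] for [x >= 1]. *)
Lemma energy_decay (R : realType) (b x : R) : 3 / 2 <= b -> 1 <= x ->
  energy b x <= (b - 1) / x.
Proof.
move=> b_ge x1; have x0 : 0 < x by lra.
pose f : R -> R :=
  cst 2 * (id * (energy b + bessel b * dbessel b)) +
  cst (b - 1) * bessel b ^+ 2.
have f_nincr := @is_derive_le0_nonincreasing R f
  (fun y => (2 * (3 - 2 * b)) * (y * dbessel b y ^+ 2)) 0.
have := f_nincr _ _ 0 x.
rewrite /f !fctE bessel0 mul0r mulr0 add0r => /(_ _ _ (lexx 0) (ltW x0)) fx.
have {}fx : 2 * (x * (energy b x + bessel b x * dbessel b x)) +
    (b - 1) * bessel b x ^+ 2 <= (b - 1) * 1 ^+ 2.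
  apply: fx => y y0.
    have [d2 hd2 e2] := is_derive_dbessel y b_ge.
    have h := is_derive_bessel y b_ge; have hE := is_derive_energy y b_ge.
    by apply: is_derive_eq; rewrite /GRing.scale/= energyE; ring: e2.
  apply: mulr_le0_ge0; first lra.
  by rewrite mulr_ge0 ?sqr_ge0.
rewrite ler_pdivlMr//; move: fx; rewrite energyE expr1n mulr1.
move: (bessel b x) (dbessel b x) => p q.
have b1 : 0 <= b - 1 by lra.
have := mulr_ge0 (ltW x0) (sqr_ge0 (p + q)).
have := mulr_ge0 b1 (sqr_ge0 p).
have x2 : 0 <= x * (x - 1) by apply: mulr_ge0; lra.
have := mulr_ge0 x2 (sqr_ge0 q).
lra.
Qed.

Lemma normr_bessel_le1 (R : realType) (b x : R) : 3 / 2 <= b -> 0 <= x ->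
  `|bessel b x| <= 1.
Proof.
move=> b_ge x0; rewrite -[leRHS](expr1n R 2) -ler_sqr ?nnegrE//.
rewrite real_normK ?num_real//.
have := energy_le1 b_ge x0; rewrite energyE.
have := mulr_ge0 x0 (sqr_ge0 (dbessel b x)); lra.
Qed.

(** * Comparison principle and growth of the weighted mean *)

Lemma powR_pred (R : realType) (x s : R) : 0 < x -> x `^ s = x * x `^ (s - 1).
Proof.
move=> x0; rewrite -{2}(powRr1 (ltW x0)) -powRD ?(gt_eqF x0) ?implybT//.
by rewrite addrC subrK.
Qed.

Lemma powR_mul (R : realType) (x s t : R) : 0 < x ->
  x `^ s * x `^ t = x `^ (s + t).
Proof. by move=> x0; rewrite powRD// (gt_eqF x0) implybT. Qed.

Lemma powR_ge1 (R : realType) (x s : R) : 1 <= x -> 0 <= s -> 1 <= x `^ s.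
Proof. by move=> x1 s0; rewrite -[leLHS](powRr0 x) ler_powR. Qed.

Lemma powRN_small (R : realType) (s e : R) : 0 < s -> 0 < e ->
  exists2 X : R, 1 <= X & forall x, X <= x -> x `^ (- s) <= e.
Proof.
move=> s0 e0; exists (Num.max 1 (e^-1 `^ s^-1)); first by rewrite le_max lexx.
move=> x; rewrite ge_max => /andP[x1 xe].
rewrite powRN -[leRHS]invrK lef_pV2 ?posrE ?invr_gt0 ?powR_gt0//; last lra.
rewrite -[leLHS]powRr1 ?invr_ge0 ?(ltW e0)// -(mulVf (lt0r_neq0 s0)) powRrM.
by rewrite ge0_ler_powR ?nnegrE ?powR_ge0//; lra.
Qed.

(** [c x^q] solves [x h' + r h = c (r + q) x^q], and [x^r] is the integrating
    factor of the equation of [gap_mean]; the derivative therefore has the sign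
    of the difference of the right-hand sides. *)
Lemma is_derive_weighted_gap_mean (R : realType) (b r c q x : R) :
  3 / 2 <= b -> - 1 < r -> 0 < x ->
  is_derive x 1 (fun y => y `^ r * (gap_mean b r y - c * y `^ q))
    (x `^ (r - 1) * (1 - bessel b x - c * (r + q) * x `^ q)).
Proof.
move=> b_ge r_gt x0; have [d hd e] := is_derive_gap_mean x b_ge r_gt.
have hr := is_derive1_powR r x0; have hq := is_derive1_powR q x0.
have -> : (fun y => y `^ r * (gap_mean b r y - c * y `^ q)) =
    (@powR R)^~ r * (gap_mean b r - cst c * (@powR R)^~ q) by apply/funext.
apply: is_derive_eq; rewrite /GRing.scale/= !fctE.
by rewrite (powR_pred r x0) (powR_pred q x0); ring: e.
Qed.

(** [c x^q] is a supersolution for [x >= x0]; a multiple of the solution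
    [x^(-r)] of the homogeneous equation matches the values at [x0]. *)
Lemma gap_mean_le_of_gap_le (R : realType) (b r c q x0 x : R) :
  3 / 2 <= b -> - 1 < r -> 0 < x0 ->
  (forall y, x0 <= y -> 1 - bessel b y <= c * (r + q) * y `^ q) ->
  x0 <= x ->
  gap_mean b r x <=
  c * x `^ q + x `^ (- r) * (x0 `^ r * (gap_mean b r x0 - c * x0 `^ q)).
Proof.
move=> b_ge r_gt x00 gap x0x; have xp : 0 < x by lra.
rewrite -lerBlDl powRN [leRHS]mulrC ler_pdivlMr ?powR_gt0// [leLHS]mulrC.
have := @is_derive_le0_nonincreasing R
  (fun y => y `^ r * (gap_mean b r y - c * y `^ q))
  (fun y => y `^ (r - 1) * (1 - bessel b y - c * (r + q) * y `^ q)) x0.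
move=> /(_ _ _ x0 x (lexx x0) x0x); apply => y y0.
  by apply: is_derive_weighted_gap_mean => //; lra.
by rewrite mulr_ge0_le0 ?powR_ge0// subr_le0 gap.
Qed.

Lemma gap_mean_ge_of_gap_ge (R : realType) (b r c q x0 x : R) :
  3 / 2 <= b -> - 1 < r -> 0 < x0 ->
  (forall y, x0 <= y -> c * (r + q) * y `^ q <= 1 - bessel b y) ->
  x0 <= x ->
  c * x `^ q + x `^ (- r) * (x0 `^ r * (gap_mean b r x0 - c * x0 `^ q)) <=
  gap_mean b r x.
Proof.
move=> b_ge r_gt x00 gap x0x; have xp : 0 < x by lra.
rewrite -lerBrDl powRN [leLHS]mulrC ler_pdivrMr ?powR_gt0// [leRHS]mulrC -lerN2.
have := @is_derive_le0_nonincreasing R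
  (- (fun y => y `^ r * (gap_mean b r y - c * y `^ q)))
  (fun y => - (y `^ (r - 1) * (1 - bessel b y - c * (r + q) * y `^ q))) x0.
move=> /(_ _ _ x0 x (lexx x0) x0x); apply => y y0.
  by apply: is_deriveN; apply: is_derive_weighted_gap_mean => //; lra.
by rewrite oppr_le0 mulr_ge0 ?powR_ge0// subr_ge0 gap.
Qed.

Lemma bessel_le1 (R : realType) (b x : R) : 3 / 2 <= b -> 0 <= x ->
  bessel b x <= 1.
Proof.
by move=> b_ge x0; rewrite (le_trans (ler_norm _))// normr_bessel_le1.
Qed.

Lemma gap_le2 (R : realType) (b x : R) : 3 / 2 <= b -> 0 <= x ->
  1 - bessel b x <= 2.
Proof.
by move=> b_ge x0; have := normr_bessel_le1 b_ge x0; rewrite ler_norml; lra.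
Qed.

Lemma bessel_small (R : realType) (b e : R) : 3 / 2 <= b -> 0 < e ->
  exists2 X : R, 1 <= X & forall x, X <= x -> `|bessel b x| <= e.
Proof.
move=> b_ge e0; have e2 : 0 < e ^+ 2 by rewrite exprn_gt0.
have be : 0 <= (b - 1) / e ^+ 2 by rewrite divr_ge0 ?(ltW e2)//; lra.
exists (1 + (b - 1) / e ^+ 2) => [|x xX]; first by rewrite lerDl.
have x1 : 1 <= x by lra.
have x0 : 0 < x by lra.
rewrite -ler_sqr ?nnegrE ?(ltW e0)// real_normK ?num_real//.
have := energy_decay b_ge x1; rewrite energyE => E.
have := mulr_ge0 (ltW x0) (sqr_ge0 (dbessel b x)).
suff : (b - 1) / x <= e ^+ 2 by lra.
by rewrite ler_pdivrMr// mulrC -ler_pdivrMr//; lra.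
Qed.

Lemma gap_mean_ge_powRN (R : realType) (b r x : R) :
  3 / 2 <= b -> - 1 < r -> 1 <= x ->
  x `^ (- r) * gap_mean b r 1 <= gap_mean b r x.
Proof.
move=> b_ge r_gt x1.
(* Zero is a subsolution. *)
have := @gap_mean_ge_of_gap_ge _ b r 0 0 1 x b_ge r_gt ltr01 _ x1.
rewrite !mul0r subr0 add0r powR1 mul1r; apply => y y1.
by rewrite mul0r subr_ge0 bessel_le1//; lra.
Qed.

(** For [r < 0] the homogeneous solution [x^(-r)] dominates. For [r >= 0] a
    small constant is a subsolution as soon as [bessel b <= 1/2]. *)
Lemma gap_mean_lower (R : realType) (b r : R) :
  3 / 2 <= b -> - 1 < r -> 0 < gap_mean b r 1 ->
  exists2 c : R, 0 < c & exists2 X : R, 1 <= X &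
    forall x, X <= x -> c * x `^ Num.max 0 (- r) <= gap_mean b r x.
Proof.
move=> b_ge r_gt m1; have [r0|r0] := ltP r 0.
  exists (gap_mean b r 1) => //; exists 1 => // x x1.
  by rewrite max_r; [rewrite mulrC gap_mean_ge_powRN|lra].
have [X X1 hX] := @bessel_small _ b (1 / 2) b_ge ltac:(lra).
have mX : 0 < gap_mean b r X.
  apply: lt_le_trans (gap_mean_ge_powRN b_ge r_gt X1).
  by rewrite mulr_gt0 ?powR_gt0//; lra.
set c := Num.min (gap_mean b r X) (1 / (2 * (r + 1))).
have c0 : 0 < c by rewrite lt_min mX/= divr_gt0//; lra.
exists c => //; exists X => // x Xx; have x1 : 1 <= x by lra.
rewrite max_l; last lra.
have := @gap_mean_ge_of_gap_ge _ b r c 0 X x b_ge r_gt ltac:(lra) _ Xx.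
move=> h; apply: le_trans (h _) => [|y Xy].
  rewrite lerDl !mulr_ge0 ?powR_ge0// subr_ge0 powRr0 mulr1.
  by rewrite /c ge_min lexx.
have := hX _ Xy; rewrite ler_norml powRr0 mulr1 addr0.
suff : c * r <= 1 / 2 by lra.
have : c <= 1 / (2 * (r + 1)) by rewrite /c ge_min lexx orbT.
rewrite ler_pdivlMr; last lra.
by have := mulr_ge0 (ltW c0) r0; lra.
Qed.

(** A large multiple of [x^q] is a supersolution for [x >= 1], as
    [1 - bessel b <= 2]. Asking for [max(0, -r) < q] rather than for the optimal
    exponent treats all signs of [r] at once, including the logarithmic growth
    at [r = 0]. *)
Lemma gap_mean_upper (R : realType) (b r q : R) :
  3 / 2 <= b -> - 1 < r -> Num.max 0 (- r) < q ->
  exists2 c : R, 0 < c & forall x, 1 <= x -> gap_mean b r x <= c * x `^ q.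
Proof.
move=> b_ge r_gt; rewrite gt_max => /andP[q0 rq].
have rq0 : 0 < r + q by lra.
exists (Num.max (gap_mean b r 1) (2 / (r + q))) => [|x x1].
  by rewrite lt_max divr_gt0 ?orbT.
set c := Num.max _ _.
have h := @gap_mean_le_of_gap_le _ b r c q 1 x b_ge r_gt ltr01 _ x1.
apply: le_trans (h _) _ => [y y1|].
  have := @gap_le2 _ b y b_ge ltac:(lra) => /le_trans; apply.
  rewrite -[leLHS]mulr1; apply: ler_pM => //; last by rewrite powR_ge1// ltW.
  by rewrite -ler_pdivrMr// /c le_max lexx orbT.
rewrite gerDl mulr_ge0_le0 ?powR_ge0// powR1 mul1r mulr1 subr_le0.
by rewrite /c le_max lexx.
Qed.

(** This is [x^(-r) * int_0^x y^(r-1) (1 - w y) dy] with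
    [w y = bessel b y + 2 y bessel' b y], after integrating the second summand
    by parts. The function [w] need not tend to [0] (it is [cos (2 sqrt y)] for
    [b = 3/2], that is in dimension one), whereas [bessel b] does. *)
Definition axial (R : realType) (b r x : R) : R :=
  (1 - 2 * r) * gap_mean b r x + 2 * (1 - bessel b x).

(** For [r <= 1/2] both summands are nonnegative and one of them is large
    enough. For [r > 1/2] the first one is negative, and the sharp upper bound
    [limsup gap_mean <= 1/r] is needed: [(1 - 2 r) / r + 2 = 1 / r > 0]. *)
Lemma axial_lower (R : realType) (b r : R) :
  3 / 2 <= b -> - 1 < r -> 0 < gap_mean b r 1 ->
  exists2 c : R, 0 < c & exists2 X : R, 1 <= X &
    forall x, X <= x -> c * x `^ Num.max 0 (- r) <= axial b r x.
Proof.
move=> b_ge r_gt m1.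
have mpos x : 1 <= x -> 0 < gap_mean b r x.
  move=> x1; apply: lt_le_trans (gap_mean_ge_powRN b_ge r_gt x1).
  by rewrite mulr_gt0 ?powR_gt0//; lra.
have [r0|r0] := ltP r 0.
  have [c c0 [X X1 h]] := gap_mean_lower b_ge r_gt m1.
  exists c => //; exists X => // x Xx; apply: le_trans (h _ Xx) _.
  have x1 : 1 <= x by lra.
  have := @bessel_le1 _ b x b_ge ltac:(lra); have := mpos _ x1 => mx.
  have := @mulr_ge0 _ (- r) _ ltac:(lra) (ltW mx); rewrite /axial.
  lra.
have -> : Num.max 0 (- r) = 0 by rewrite max_l//; lra.
have [r2|r2] := leP r (1 / 2).
  have [X X1 hX] := @bessel_small _ b (1 / 2) b_ge ltac:(lra).
  exists 1 => //; exists X => // x Xx; rewrite powRr0 /axial.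
  have x1 : 1 <= x by lra.
  have := hX _ Xx; rewrite ler_norml.
  by have := @mulr_ge0 _ (1 - 2 * r) _ ltac:(lra) (ltW (mpos _ x1)); lra.
have r1 : 0 < r by lra.
(* Once [|bessel b| <= e], the constant [c = (1 + e) / r] is a supersolution.
   Replacing [0] by [e] costs [4 e], half of the limiting value [1 / r = 8 e];
   the homogeneous part [x^(-r) K] costs at most a further quarter. *)
set e := 1 / (8 * r); have e0 : 0 < e by rewrite divr_gt0//; lra.
have [X X1 hX] := @bessel_small _ b e b_ge e0.
set c := (1 + e) / r; have cr : c * r = 1 + e by rewrite /c divfK//; lra.
set K := X `^ r * `|gap_mean b r X - c| + 1.
have K0 : 0 < K by rewrite /K ltr_wpDl// mulr_ge0 ?powR_ge0.
have q0 : 0 < 8 * r ^+ 2 by rewrite mulr_gt0 ?exprn_gt0.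
have [X' X'1 hX'] := @powRN_small _ r (1 / (8 * r ^+ 2 * K)) r1
  ltac:(by rewrite divr_gt0// mulr_gt0).
exists (1 / (4 * r)); first by rewrite divr_gt0//; lra.
exists (Num.max X X'); first by rewrite le_max X1.
move=> x; rewrite ge_max powRr0 mulr1 => /andP[Xx X'x].
have x1 : 1 <= x by lra.
have h : gap_mean b r x <= c + 1 / (8 * r ^+ 2).
  have := @gap_mean_le_of_gap_le _ b r c 0 X x b_ge r_gt ltac:(lra) _ Xx.
  rewrite !powRr0 !mulr1 addr0 => h; apply: le_trans (h _) _ => [y Xy|].
    by have := hX _ Xy; rewrite ler_norml powRr0; lra.
  rewrite lerD2l; apply: (@le_trans _ _ (x `^ (- r) * K)).
    rewrite ler_wpM2l ?powR_ge0// /K.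
    apply: (@le_trans _ _ (X `^ r * `|gap_mean b r X - c|)).
      by rewrite ler_wpM2l ?powR_ge0// ler_norm.
    by rewrite lerDl.
  have := ler_wpM2r (ltW K0) (hX' _ X'x) => /le_trans; apply.
  rewrite (_ : _ / _ * K = 1 / (8 * r ^+ 2))//; field.
  by rewrite (lt0r_neq0 K0) (lt0r_neq0 r1).
have := hX _ Xx; rewrite ler_norml /axial => phix.
have {}h := @ler_wpM2l _ (2 * r - 1) ltac:(lra) _ _ h.
have c2 : (2 * r - 1) * (c + 1 / (8 * r ^+ 2)) =
    2 + 2 * e - c + (2 * r - 1) / (8 * r ^+ 2).
  have -> : 2 + 2 * e = 2 * (c * r) by rewrite cr; ring.
  by field; lra.
have c3 : c = 1 / r + e / r by rewrite /c; field; lra.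
have c4 : (2 * r - 1) / (8 * r ^+ 2) <= 1 / (4 * r).
  have -> : 1 / (4 * r) = (2 * r) / (8 * r ^+ 2) by field; lra.
  by rewrite ler_wpM2r ?invr_ge0 ?(ltW q0)//; lra.
have c5 : 1 / r = 8 * e by rewrite /e; field; lra.
have c6 : 1 / (4 * r) = 2 * e by rewrite /e; field; lra.
have c7 : 0 <= e / r by rewrite divr_ge0 ?ltW.
lra.
Qed.

(** * The three hypergeometric functions *)

Lemma eq_cvg_pseries (R : realType) (c d : nat -> R) (x k l : R) :
  c =1 d -> k = l -> pseries c x @ \oo --> k -> pseries d x @ \oo --> l.
Proof. by move=> /funext -> ->. Qed.

Lemma cvg_pseries_unshift (R : realType) (c : nat -> R) (x l : R) :
  c 0%N = 0 -> x != 0 -> pseries c x @ \oo --> l ->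
  pseries (fun m => c m.+1) x @ \oo --> l / x.
Proof.
move=> c0 x0 cl.
have {}cl : pseries c x N.+1 @[N --> \oo] --> l.
  by rewrite (cvg_shiftS (pseries c x)).
apply: cvg_trans (cvgM cl (cvg_cst x^-1)); apply: near_eq_cvg; near=> N.
rewrite /pseries/= /series/= big_nat_recl//= c0 mul0r add0r mulr_suml.
by apply: eq_bigr => m _; rewrite exprSr mulrA mulfK.
Unshelve. all: by end_near. Qed.

Lemma hypergeom_pseries (R : realType) (a b : seq R) (u : nat -> R) (x l : R) :
  (forall m, (\prod_(c <- a) pochhammer c m) / (\prod_(c <- b) pochhammer c m)
     * ((- 1) ^+ m / m`!%:R) = u m) ->
  pseries u x @ \oo --> l -> hypergeom a b (- x) = l.
Proof.
move=> ab ul; apply: (cvg_lim (@norm_hausdorff _ _)).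
rewrite (_ : series _ = pseries u x)//; apply/funext => N.
rewrite /pseries /series/=; apply: eq_bigr => m _.
by rewrite -ab -[RHS]mulrA; congr (_ * _); rewrite [in LHS]exprNn mulrAC.
Qed.

Lemma pochhammer_gt0 (R : realType) (a : R) m : 0 < a -> 0 < pochhammer a m.
Proof. by move=> a0; apply: prodr_gt0 => i _; rewrite ltr_wpDr. Qed.

Lemma pochhammer_recl (R : realType) (a : R) m :
  pochhammer a m.+1 = a * pochhammer (a + 1) m.
Proof.
rewrite /pochhammer big_ord_recl addr0; congr (_ * _).
by apply: eq_bigr => i _; rewrite /= /bump/= natrD addrA.
Qed.

Lemma pochhammer_add1 (R : realType) (a : R) m : a != 0 ->
  pochhammer (a + 1) m = pochhammer a m * (a + m%:R) / a.
Proof. by move=> a0; rewrite -pochhammerS pochhammer_recl mulrC mulKf. Qed.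

Lemma pochhammer1 (R : realType) m : pochhammer (1 : R) m = m`!%:R.
Proof.
elim: m => [|m IH]; first by rewrite /pochhammer big_ord0.
by rewrite pochhammerS IH factS mulnC natrM nat1r.
Qed.

Lemma axial_cvg (R : realType) (b r x : R) : 3 / 2 <= b -> - 1 < r ->
  pseries (fun m => if m == 0%N then 0 else
    - (bessel_coef b m * (2 * m%:R + 1) / (r + m%:R))) x @ \oo --> axial b r x.
Proof.
move=> b_ge r_gt; have cB := bessel_coef_bounded b_ge.
have mB := gap_mean_coef_bounded b_ge r_gt.
apply: eq_cvg_pseries (cvg_pseriesD
  (cvg_pseriesZ (a := 1 - 2 * r) (psum_cvg (x := x) mB))
  (cvg_pseriesZ (a := 2) (cvg_pseriesD (@cvg_pseries_const R x 1)
    (cvg_pseriesZ (a := - 1) (psum_cvg (x := x) cB))))); last first.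
  by rewrite mulN1r.
move=> m; rewrite /gap_mean_coef; case: eqVneq => [->|m0].
  by rewrite /bessel_coef /pochhammer big_ord0 fact0 expr0; field.
have mr := addr1_le_addrn r m0; have m0' : 0 <= m%:R :> R by [].
by field; lra.
Qed.

(** This is [(r + 1) x^(-r-1) * int_0^x y^r bessel b y dy], rewritten with the
    Bessel equation. A direct estimate of the integral by [|bessel b|] would
    lose the cancellation due to the oscillation and be too weak for [b = 3/2];
    here each term is estimated by itself. *)
Definition bessel_mean (R : realType) (b r x : R) : R :=
  (r + 1) * ((b - (r + 1)) * ((1 - bessel b x) - r * gap_mean b r x)
             - x * dbessel b x) / x.

Lemma hypergeom12 (R : realType) (b r x : R) :
  3 / 2 <= b -> - 1 < r -> 0 < x ->
  hypergeom [:: r + 1] [:: b; r + 1 + 1] (- x) = bessel_mean b r x.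
Proof.
move=> b_ge r_gt x0; have cB := bessel_coef_bounded b_ge.
have mB := gap_mean_coef_bounded b_ge r_gt.
apply: (@hypergeom_pseries _ _ _
  (fun m => (r + 1) * (bessel_coef b m / (r + 1 + m%:R)))).
  move=> m; have r1 : r + 1 != 0 by rewrite lt0r_neq0//; lra.
  rewrite !big_cons !big_nil !mulr1 (pochhammer_add1 _ r1).
  have m0 : 0 <= m%:R :> R by [].
  have p1 := @pochhammer_gt0 _ b m ltac:(lra).
  have p2 := @pochhammer_gt0 _ (r + 1) m ltac:(lra).
  have f0 : (m`!%:R : R) != 0 by rewrite pnatr_eq0 -lt0n fact_gt0.
  by rewrite /bessel_coef; field; rewrite f0 !lt0r_neq0//; lra.
(* The coefficients of [x * bessel_mean b r x]. *)
pose d m := (r + 1) * ((b - (r + 1)) * ((if m == 0%N then 1 else 0) +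
  - 1 * bessel_coef b m + (- r) * gap_mean_coef b r m) +
  - 1 * (m%:R * bessel_coef b m)).
have dl : pseries d x @ \oo --> (r + 1) *
    ((b - (r + 1)) * (1 + - 1 * bessel b x + (- r) * gap_mean b r x) +
     - 1 * (x * dbessel b x)).
  apply/cvg_pseriesZ/cvg_pseriesD; last exact/cvg_pseriesZ/cvg_pseries_euler.
  apply/cvg_pseriesZ/cvg_pseriesD; last exact/cvg_pseriesZ/psum_cvg.
  apply/cvg_pseriesD; first exact: cvg_pseries_const.
  exact/cvg_pseriesZ/psum_cvg.
have d0 : d 0%N = 0.
  rewrite /d/gap_mean_coef/bessel_coef/pochhammer big_ord0 fact0 expr0/=.
  by field.
have := cvg_pseries_unshift d0 (lt0r_neq0 x0) dl.
rewrite (_ : _ / x = bessel_mean b r x); last first.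
  by rewrite /bessel_mean; congr (_ / _); ring.
rewrite (_ : (fun m => d m.+1) =
  (fun m => (r + 1) * (bessel_coef b m / (r + 1 + m%:R))))//.
apply/funext => m; rewrite /d /gap_mean_coef/= -[bessel_coef b m]opprK.
have m0 : 0 <= m%:R :> R by [].
rewrite -bessel_coefS//; field; rewrite lt0r_neq0//=; lra.
Qed.

Lemma hypergeom23 (R : realType) (b r x : R) :
  3 / 2 <= b -> - 1 < r -> 0 < x ->
  hypergeom [:: 1; r + 1] [:: 2; b + 1; r + 1 + 1] (- x) =
  (r + 1) * b * gap_mean b r x / x.
Proof.
move=> b_ge r_gt x0; have mB := gap_mean_coef_bounded b_ge r_gt.
apply: (@hypergeom_pseries _ _ _
  (fun m => (r + 1) * b * gap_mean_coef b r m.+1)).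
  move=> m; have r1 : r + 1 != 0 by rewrite lt0r_neq0//; lra.
  have b0 : b != 0 by rewrite lt0r_neq0//; lra.
  rewrite !big_cons !big_nil !mulr1 pochhammer1.
  rewrite -(nat1r 1).
  rewrite (pochhammer_add1 _ r1) (pochhammer_add1 _ b0).
  rewrite (pochhammer_add1 _ (oner_neq0 _)).
  have m0 : 0 <= m%:R :> R by [].
  have p1 := @pochhammer_gt0 _ b m ltac:(lra).
  have p2 := @pochhammer_gt0 _ (r + 1) m ltac:(lra).
  have f0 : (m`!%:R : R) != 0 by rewrite pnatr_eq0 -lt0n fact_gt0.
  rewrite pochhammer1 /gap_mean_coef/= /bessel_coef pochhammerS factS natrM.
  rewrite exprS.
  by field; rewrite f0 !lt0r_neq0//; lra.
apply: (@cvg_pseries_unshift _ (fun m => (r + 1) * b * gap_mean_coef b r m)).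
- by rewrite /gap_mean_coef/= mulr0.
- exact: lt0r_neq0.
- exact/cvg_pseriesZ/psum_cvg.
Qed.

(** The quotient [(5/2)_m / (3/2)_m = (2 m + 3) / 3] explains the factor
    [2 m + 1] in the coefficients of [axial]. *)
Lemma hypergeom34 (R : realType) (b r x : R) :
  3 / 2 <= b -> - 1 < r -> 0 < x ->
  hypergeom [:: 1; 5 / 2; r + 1] [:: 2; 3 / 2; b + 1; r + 1 + 1] (- x) =
  (r + 1) * b / 3 * axial b r x / x.
Proof.
move=> b_ge r_gt x0; have ac := @axial_cvg _ b r x b_ge r_gt.
set d := (fun m => _) in ac.
apply: (@hypergeom_pseries _ _ _ (fun m => (r + 1) * b / 3 * d m.+1)).
  move=> m; have r1 : r + 1 != 0 by rewrite lt0r_neq0//; lra.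
  have b0 : b != 0 by rewrite lt0r_neq0//; lra.
  rewrite !big_cons !big_nil !mulr1 pochhammer1.
  rewrite (_ : 5 / 2 = 3 / 2 + 1); last by field.
  rewrite -(nat1r 1) (@pochhammer_add1 _ (3 / 2))//.
  rewrite (pochhammer_add1 _ r1) (pochhammer_add1 _ b0).
  rewrite (pochhammer_add1 _ (oner_neq0 _)).
  have m0 : 0 <= m%:R :> R by [].
  have p1 := @pochhammer_gt0 _ b m ltac:(lra).
  have p2 := @pochhammer_gt0 _ (r + 1) m ltac:(lra).
  have p3 := @pochhammer_gt0 R (3 / 2) m ltac:(lra).
  have f0 : (m`!%:R : R) != 0 by rewrite pnatr_eq0 -lt0n fact_gt0.
  rewrite pochhammer1 /d/= /bessel_coef pochhammerS factS natrM exprS.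
  by field; rewrite f0 !lt0r_neq0//; lra.
apply: (@cvg_pseries_unshift _ (fun m => (r + 1) * b / 3 * d m)).
- by rewrite /d/= mulr0.
- exact: lt0r_neq0.
- exact/cvg_pseriesZ.
Qed.

(** * The remainder in the axial eigenvalue *)

Lemma bessel_mean_bound (R : realType) (b r q : R) :
  3 / 2 <= b -> - 1 < r -> 0 < gap_mean b r 1 -> Num.max 0 (- r) < q ->
  exists2 M : R, 0 < M &
    forall x, 1 <= x -> x * (x * bessel_mean b r x ^+ 2) <= M * (x `^ q) ^+ 2.
Proof.
move=> b_ge r_gt m1 rq; have [C C0 hC] := gap_mean_upper b_ge r_gt rq.
have q0 : 0 <= q by move: rq; rewrite gt_max => /andP[/ltW].
set B := b - (r + 1).
have B2 : 0 <= B ^+ 2 by exact: sqr_ge0.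
have BC2 : 0 <= (B * r * C) ^+ 2 by exact: sqr_ge0.
exists ((r + 1) ^+ 2 * (3 * (4 * B ^+ 2 + (B * r * C) ^+ 2 + (b - 1)))).
  by rewrite mulr_gt0 ?exprn_gt0//; lra.
move=> x x1; have x0 : 0 < x by lra.
have -> : x * (x * bessel_mean b r x ^+ 2) = (r + 1) ^+ 2 *
    (B * (1 - bessel b x) - B * r * gap_mean b r x - x * dbessel b x) ^+ 2.
  by rewrite /bessel_mean /B; field; rewrite gt_eqF.
rewrite -[leRHS]mulrA ler_wpM2l ?sqr_ge0//.
have m0 : 0 <= gap_mean b r x.
  apply: le_trans (gap_mean_ge_powRN b_ge r_gt x1).
  by rewrite mulr_ge0 ?powR_ge0 ?ltW.
have xq1 := powR_ge1 x1 q0.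
have xq2 : 1 <= (x `^ q) ^+ 2.
  by rewrite -[leLHS](expr1n R 2) lerXn2r ?nnegrE//; lra.
have h1 : (B * (1 - bessel b x)) ^+ 2 <= 4 * B ^+ 2 * (x `^ q) ^+ 2.
  rewrite exprMn.
  rewrite (_ : 4 * B ^+ 2 * _ = B ^+ 2 * (2 * x `^ q) ^+ 2); last by ring.
  have := @gap_le2 _ b x b_ge (ltW x0); have := bessel_le1 b_ge (ltW x0).
  by move=> g0 g2; rewrite ler_wpM2l// lerXn2r ?nnegrE//; lra.
have h2 : (B * r * gap_mean b r x) ^+ 2 <= (B * r * C) ^+ 2 * (x `^ q) ^+ 2.
  rewrite -exprMn -[B * r * C * _]mulrA 2![(B * r * _) ^+ 2]exprMn.
  by rewrite ler_wpM2l ?sqr_ge0// lerXn2r ?nnegrE ?hC//; have := hC _ x1; lra.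
have h3 : (x * dbessel b x) ^+ 2 <= (b - 1) * (x `^ q) ^+ 2.
  apply: (@le_trans _ _ (b - 1)); last by rewrite ler_peMr//; lra.
  have := energy_decay b_ge x1; rewrite ler_pdivlMr// energyE.
  by have := mulr_ge0 (ltW x0) (sqr_ge0 (bessel b x)); lra.
move: h1 h2 h3.
set u := B * _; set v := _ * gap_mean b r x; set w := x * _ => h1 h2 h3.
(* Together these squares say that [(u - v - w)^2 <= 3 (u^2 + v^2 + w^2)]. *)
have := sqr_ge0 (u + v); have := sqr_ge0 (u + w); have := sqr_ge0 (v - w).
lra.
Qed.

(** With [rho = max(0, -r) < 1], the bound [x^(2 q - 1)] that results from
    [bessel_mean_bound] is [o(x^rho)] as soon as [q < (1 + rho) / 2], and such a
    [q] above [rho] exists. *)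
Lemma bessel_mean_small (R : realType) (b r e : R) :
  3 / 2 <= b -> - 1 < r -> 0 < gap_mean b r 1 -> 0 < e ->
  exists2 X : R, 1 <= X & forall x, X <= x ->
    x * bessel_mean b r x ^+ 2 <= e * x `^ Num.max 0 (- r).
Proof.
move=> b_ge r_gt m1 e0; set rho := Num.max 0 (- r).
have rho0 : 0 <= rho by rewrite le_max lexx.
have rho1 : rho < 1 by rewrite gt_max ltr01; lra.
have [M M0 hM] := @bessel_mean_bound _ b r ((1 + 3 * rho) / 4) b_ge r_gt m1
  ltac:(rewrite -/rho; lra).
have [X X1 hX] := @powRN_small _ ((1 - rho) / 2) (e / M) ltac:(lra)
  ltac:(by rewrite divr_gt0).
exists X => // x Xx; have x1 : 1 <= x by lra.
have x0 : 0 < x by lra.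
rewrite -(ler_pM2l x0); apply: le_trans (hM _ x1) _.
rewrite expr2 powR_mul//.
have -> : (1 + 3 * rho) / 4 + (1 + 3 * rho) / 4 =
    1 + (rho + - ((1 - rho) / 2)) by field.
rewrite -powR_mul// powRr1 ?(ltW x0)// mulrCA ler_pM2l// -powR_mul//.
rewrite mulrCA mulrC.
rewrite ler_wpM2r ?powR_ge0//.
by have := hX _ Xx; rewrite ler_pdivlMr// mulrC.
Qed.

Lemma axial_bessel_mean_lower (R : realType) (b r k l : R) :
  3 / 2 <= b -> - 1 < r -> 0 < gap_mean b r 1 -> 0 < k ->
  exists2 c : R, 0 < c & exists2 X : R, 1 <= X & forall x, X <= x ->
    c * x `^ Num.max 0 (- r) <=
    k * axial b r x + l * (x * bessel_mean b r x ^+ 2).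
Proof.
move=> b_ge r_gt m1 k0; have [c c0 [X X1 hX]] := axial_lower b_ge r_gt m1.
have kc0 : 0 < k * c by rewrite mulr_gt0.
have l1 : 0 < 2 * (`|l| + 1) by rewrite mulr_gt0// ltr_wpDl.
have [X' X'1 hX'] :=
  @bessel_mean_small _ b r (k * c / (2 * (`|l| + 1))) b_ge r_gt m1
  ltac:(by rewrite divr_gt0).
exists (k * c / 2); first by rewrite divr_gt0.
exists (Num.max X X'); first by rewrite le_max X1.
move=> x; rewrite ge_max => /andP[/hX Xx X'x].
have x0 : 0 < x by lra.
move: Xx (hX' _ X'x).
set p := x `^ _; set s := x * bessel_mean _ _ _ ^+ 2 => Xx h.
have p0 : 0 <= p by exact: powR_ge0.
have s0 : 0 <= s by rewrite mulr_ge0 ?sqr_ge0 ?ltW.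
have {}Xx := ler_wpM2l (ltW k0) Xx.
have ls : - (`|l| * s) <= l * s.
  by rewrite -mulNr ler_wpM2r// lerNl -normrN ler_norm.
have : (2 * (`|l| + 1)) * s <= k * c * p.
  by move: h; rewrite mulrAC ler_pdivlMr// mulrC.
lra.
Qed.

(** * Lower bounds for the eigenvalues *)

(** Minus the eigenvalues, as functions of [s = |v|^2] alone; [d * s] is the
    argument [x] of the Bessel type functions. *)
Definition transverse_profile (R : realType) (delta mu b r s : R) : R :=
  let d := delta ^+ 2 / 4 in
  d^-1 * (mu * (r + 1) * b * gap_mean b r (d * s)).

Definition axial_profile (R : realType) (delta mu lam b r s : R) : R :=
  let d := delta ^+ 2 / 4 in
  d^-1 * (mu * (r + 1) * b * axial b r (d * s) +
          (lam - mu) * (d * s * bessel_mean b r (d * s) ^+ 2)).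

Lemma sqnorm_ge0 (R : realType) n (v : 'cV[R]_n) : 0 <= sqnorm v.
Proof. by apply: sumr_ge0 => i _; exact: sqr_ge0. Qed.

Lemma sqnorm_gt0 (R : realType) n (v : 'cV[R]_n) : v != 0 -> 0 < sqnorm v.
Proof.
by move=> v0; rewrite lt_neqAle eq_sym sqnorm_eq0 v0/= sqnorm_ge0.
Qed.

Lemma lambda2E (R : realType) n (delta mu beta : R) (v : 'cV[R]_n) :
  (1 <= n)%N -> 0 < delta -> beta < n%:R + 2 -> v != 0 ->
  lambda2 delta mu beta v =
  - transverse_profile delta mu ((n%:R + 2) / 2) ((n%:R - beta) / 2) (sqnorm v).
Proof.
move=> n1 d0 hb v0; have s0 := sqnorm_gt0 v0.
have n1' : 1 <= n%:R :> R by rewrite ler1n.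
have x0 : 0 < delta ^+ 2 / 4 * sqnorm v.
  by rewrite mulr_gt0// divr_gt0// exprn_gt0.
rewrite /lambda2 /transverse_profile.
have := @hypergeom23 R ((n%:R + 2) / 2) ((n%:R - beta) / 2) _
  ltac:(lra) ltac:(lra) x0.
rewrite (_ : (n%:R - beta) / 2 + 1 = (n%:R + 2 - beta) / 2); last by field.
rewrite (_ : (n%:R + 2) / 2 + 1 = (n%:R + 4) / 2); last by field.
rewrite (_ : (n%:R + 2 - beta) / 2 + 1 = (n%:R + 4 - beta) / 2); last by field.
rewrite (_ : - (delta ^+ 2 / 4 * sqnorm v) =
  - (1 / 4) * (sqnorm v * delta ^+ 2)); last by field.
by move=> ->; field; rewrite !gt_eqF.
Qed.

Lemma lambda1E (R : realType) n (delta mu lam beta : R) (v : 'cV[R]_n) :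
  (1 <= n)%N -> 0 < delta -> beta < n%:R + 2 -> v != 0 ->
  lambda1 delta mu lam beta v =
  - axial_profile delta mu lam ((n%:R + 2) / 2) ((n%:R - beta) / 2) (sqnorm v).
Proof.
move=> n1 d0 hb v0; have s0 := sqnorm_gt0 v0.
have n1' : 1 <= n%:R :> R by rewrite ler1n.
have x0 : 0 < delta ^+ 2 / 4 * sqnorm v.
  by rewrite mulr_gt0// divr_gt0// exprn_gt0.
rewrite /lambda1 /axial_profile.
have := @hypergeom34 R ((n%:R + 2) / 2) ((n%:R - beta) / 2) _
  ltac:(lra) ltac:(lra) x0.
have := @hypergeom12 R ((n%:R + 2) / 2) ((n%:R - beta) / 2) _
  ltac:(lra) ltac:(lra) x0.
rewrite (_ : (n%:R - beta) / 2 + 1 = (n%:R + 2 - beta) / 2); last by field.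
rewrite (_ : (n%:R + 2) / 2 + 1 = (n%:R + 4) / 2); last by field.
rewrite (_ : (n%:R + 2 - beta) / 2 + 1 = (n%:R + 4 - beta) / 2); last by field.
rewrite (_ : - (delta ^+ 2 / 4 * sqnorm v) =
  - (1 / 4) * (sqnorm v * delta ^+ 2)); last by field.
by move=> -> ->; field; rewrite !gt_eqF.
Qed.

Lemma exists_sqnorm (R : realType) n (s : R) : (1 <= n)%N -> 0 <= s ->
  exists v : 'cV[R]_n, sqnorm v = s.
Proof.
case: n => // n _ s0; exists (\col_i if i == ord0 then Num.sqrt s else 0).
rewrite /sqnorm (bigD1 ord0)//= mxE eqxx sqr_sqrtr// big1 ?addr0// => i i0.
by rewrite mxE (negbTE i0) expr0n.
Qed.

(** That [|k|^2] is a natural number is what leaves finitely many eigenvalues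
    below any bound on [|k|]. *)
Definition freq_size n (k : 'cV[int]_n) : nat := \sum_i `|k i 0%R| ^ 2.

Lemma sqnorm_freq (R : realType) n (k : 'cV[int]_n) :
  sqnorm (freq R k) = (freq_size k)%:R.
Proof.
rewrite /sqnorm /freq_size natr_sum; apply: eq_bigr => i _.
by rewrite mxE natrX -[LHS]real_normK ?num_real// natr_absz intr_norm.
Qed.

(** Induction on [N]: at each step only the value [P N%:R] is new, and it is
    positive if some [k] has [|k|^2 = N]. *)
Lemma freq_lower_bound_finite (R : realType) n (P : R -> R) (N : nat) :
  (forall k : 'cV[int]_n, k != 0 -> 0 < P (sqnorm (freq R k))) ->
  exists2 c : R, 0 < c & forall k : 'cV[int]_n, k != 0 ->
    (freq_size k < N)%N -> c <= P (sqnorm (freq R k)).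
Proof.
move=> P0; elim: N => [|N [c c0 IH]]; first by exists 1.
have [PN|PN] := ltP 0 (P N%:R); last first.
  exists c => // k k0; rewrite ltnS leq_eqVlt => /predU1P[kN|]; last exact: IH.
  by have := P0 _ k0; rewrite sqnorm_freq kN ltNge PN.
exists (Num.min c (P N%:R)); first by rewrite lt_min c0.
move=> k k0; rewrite ltnS leq_eqVlt ge_min => /predU1P[kN|kN].
  by rewrite sqnorm_freq kN lexx orbT.
by rewrite IH.
Qed.

(** A lower bound for large arguments extends to all nonzero frequencies,
    because the remaining ones give finitely many values of [|k|^2]. *)
Lemma freq_lower_bound (R : realType) n (P : R -> R) (d rho c X : R) :
  0 < d -> 0 <= rho -> 0 < c ->
  (forall v : 'cV[R]_n, v != 0 -> 0 < P (sqnorm v)) ->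
  (forall s, X <= d * s -> c * (d * s) `^ rho <= P s) ->
  exists2 c' : R, 0 < c' & forall k : 'cV[int]_n, k != 0 ->
    c' * (1 + sqnorm (freq R k)) `^ rho <= P (sqnorm (freq R k)).
Proof.
move=> d0 rho0 c0 P0 PX.
have [N NX] : exists N : nat, X / d <= N%:R.
  exists (Num.bound `|X / d|).
  by rewrite ltW// (le_lt_trans (ler_norm _))// archi_boundP.
have Q0 (k : 'cV[int]_n) : k != 0 ->
    0 < P (sqnorm (freq R k)) / (1 + sqnorm (freq R k)) `^ rho.
  rewrite -(freq_eq0 R) => k0; have := sqnorm_gt0 k0 => s0.
  by rewrite divr_gt0 ?powR_gt0 ?P0//; lra.
have [c1 c10 hc1] :=
  @freq_lower_bound_finite R n (fun s => P s / (1 + s) `^ rho) N Q0.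
exists (Num.min c1 (c * (d / 2) `^ rho)).
  by rewrite lt_min c10 mulr_gt0// powR_gt0// divr_gt0.
move=> k k0; have /sqnorm_gt0 s0 : freq R k != 0 by rewrite freq_eq0.
have s10 : 0 < (1 + sqnorm (freq R k)) `^ rho by rewrite powR_gt0//; lra.
rewrite -ler_pdivlMr// ge_min; have [kN|kN] := ltnP (freq_size k) N.
  by rewrite hc1.
have s1 : 1 <= sqnorm (freq R k).
  by move: s0; rewrite sqnorm_freq ltr0n ler1n.
have NX' : X <= d * sqnorm (freq R k).
  rewrite mulrC -ler_pdivrMr// (le_trans NX)// sqnorm_freq ler_nat.
  exact: kN.
apply/orP; right; rewrite ler_pdivlMr//; apply: le_trans (PX _ NX').
rewrite -mulrA ler_wpM2l ?(ltW c0)// -powRM; [|lra|lra].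
have h : d / 2 * (1 + sqnorm (freq R k)) <= d * sqnorm (freq R k).
  by rewrite -mulrA ler_wpM2l ?(ltW d0)//; lra.
by rewrite ge0_ler_powR ?nnegrE ?mulr_ge0//; lra.
Qed.

Lemma eigenvalues_lower (R : realType) n (delta mu lam beta : R) :
  (1 <= n)%N -> 0 < delta -> beta < n%:R + 2 -> 0 < mu ->
  (forall v : 'cV[R]_n, v != 0 -> lambda1 delta mu lam beta v < 0) ->
  (forall v : 'cV[R]_n, v != 0 -> lambda2 delta mu beta v < 0) ->
  exists2 c : R, 0 < c & forall k : 'cV[int]_n, k != 0 ->
    c * (1 + sqnorm (freq R k)) `^ (Num.max 0 (beta - n%:R) / 2) <=
      Num.min (- lambda1 delta mu lam beta (freq R k))
              (- lambda2 delta mu beta (freq R k)).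
Proof.
move=> n1 d0 hb mu0 l1 l2.
have n1' : 1 <= n%:R :> R by rewrite ler1n.
set b : R := (n%:R + 2) / 2; set r : R := (n%:R - beta) / 2.
have b_ge : 3 / 2 <= b by rewrite /b; lra.
have r_gt : - 1 < r by rewrite /r; lra.
have -> : Num.max 0 (beta - n%:R) / 2 = Num.max 0 (- r).
  by rewrite maxr_pMl ?invr_ge0// mul0r; congr (Num.max _ _); rewrite /r; field.
set d := delta ^+ 2 / 4; have dp : 0 < d by rewrite divr_gt0// exprn_gt0.
have rb0 : 0 < mu * (r + 1) * b by rewrite !mulr_gt0//; lra.
have P2 (v : 'cV[R]_n) :
    v != 0 -> 0 < transverse_profile delta mu b r (sqnorm v).
  by move=> v0; have := l2 _ v0; rewrite lambda2E// oppr_lt0.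
have P1 (v : 'cV[R]_n) :
    v != 0 -> 0 < axial_profile delta mu lam b r (sqnorm v).
  by move=> v0; have := l1 _ v0; rewrite lambda1E// oppr_lt0.
(* The negativity of [lambda2] where [x = 1] starts all lower bounds. *)
have m1 : 0 < gap_mean b r 1.
  have [v vE] := @exists_sqnorm R n d^-1 n1 ltac:(by rewrite invr_ge0 ltW).
  have v0 : v != 0 by rewrite -sqnorm_eq0 vE invr_eq0 gt_eqF.
  have := P2 _ v0; rewrite vE /transverse_profile -/d mulfV ?gt_eqF//.
  by rewrite pmulr_rgt0 ?invr_gt0// pmulr_rgt0.
have rho0 : 0 <= Num.max 0 (- r) by rewrite le_max lexx.
have [c2 c20 h2] : exists2 c : R, 0 < c & forall k : 'cV[int]_n, k != 0 ->
    c * (1 + sqnorm (freq R k)) `^ Num.max 0 (- r) <=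
    transverse_profile delta mu b r (sqnorm (freq R k)).
  have [c c0 [X X1 hX]] := gap_mean_lower b_ge r_gt m1.
  apply: (@freq_lower_bound _ _ _ d _ (d^-1 * (mu * (r + 1) * b * c)) X) => //.
    by apply: mulr_gt0; rewrite ?invr_gt0// mulr_gt0.
  move=> s sX; rewrite /transverse_profile -/d -[leLHS]mulrA.
  rewrite ler_wpM2l ?invr_ge0 ?(ltW dp)//.
  by rewrite -[leLHS]mulrA ler_wpM2l ?(ltW rb0)// hX.
have [c1 c10 h1] : exists2 c : R, 0 < c & forall k : 'cV[int]_n, k != 0 ->
    c * (1 + sqnorm (freq R k)) `^ Num.max 0 (- r) <=
    axial_profile delta mu lam b r (sqnorm (freq R k)).
  have [c c0 [X X1 hX]] :=
    @axial_bessel_mean_lower _ _ _ _ (lam - mu) b_ge r_gt m1 rb0.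
  apply: (@freq_lower_bound _ _ _ d _ (d^-1 * c) X) => //.
    by rewrite mulr_gt0 ?invr_gt0.
  move=> s sX; rewrite /axial_profile -/d -[leLHS]mulrA.
  by rewrite ler_wpM2l ?invr_ge0 ?(ltW dp)// hX.
exists (Num.min c1 c2) => [|k k0]; first by rewrite lt_min c10.
have kn0 : freq R k != 0 by rewrite freq_eq0.
rewrite lambda1E// lambda2E// !opprK le_min.
apply/andP; split; [apply: le_trans (h1 k k0)|apply: le_trans (h2 k k0)];
  by rewrite ler_wpM2r ?powR_ge0// ge_min lexx ?orbT.
Qed.

(** * Smoothing by the Fourier multiplier *)

Lemma axis_mx_mul (R : realType) n (v : 'cV[R]_n) (a b c d : R) : v != 0 ->
  axis_mx v a b *m axis_mx v c d = axis_mx v (a * c) (b * d).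
Proof.
move=> v0; apply: axis_mx_unique => // [|w vw]; rewrite -mulmxA.
  by rewrite axis_mx_eigen// -scalemxAr axis_mx_eigen// scalerA mulrC.
by rewrite (axis_mx_perp c d vw) -scalemxAr (axis_mx_perp a b vw) scalerA mulrC.
Qed.

Lemma axis_mx1 (R : realType) n (v : 'cV[R]_n) : axis_mx v 1 1 = 1%:M.
Proof. by rewrite /axis_mx !scale1r addrC subrK. Qed.

Lemma invmx_axis_mx (R : realType) n (v : 'cV[R]_n) (a b : R) :
  v != 0 -> a != 0 -> b != 0 -> invmx (axis_mx v a b) = axis_mx v a^-1 b^-1.
Proof.
move=> v0 a0 b0.
have AB : axis_mx v a b *m axis_mx v a^-1 b^-1 = 1%:M.
  by rewrite axis_mx_mul// !mulfV// axis_mx1.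
by have [Au _] := mulmx1_unit AB; rewrite -[RHS](mulKmx Au) AB mulmx1.
Qed.

Lemma axis_mxB1 (R : realType) n (v : 'cV[R]_n) (a b : R) :
  axis_mx v a b - 1%:M = axis_mx v (a - 1) (b - 1).
Proof.
rewrite -[in LHS](axis_mx1 v) /axis_mx !scalerBl !scale1r.
by rewrite opprD addrACA.
Qed.

Lemma sqnormD_perp (R : realType) n (u w : 'cV[R]_n) (a b : R) :
  u^T *m w = 0 ->
  sqnorm (a *: u + b *: w) = a ^+ 2 * sqnorm u + b ^+ 2 * sqnorm w.
Proof.
move=> /matrixP/(_ 0 0); rewrite !mxE => uw.
have {}uw : \sum_i u i 0 * w i 0 = 0.
  by rewrite -[RHS]uw; apply: eq_bigr => i _; rewrite mxE.
rewrite -[RHS](addr0) -(mulr0 (2 * a * b)) -uw /sqnorm !mulr_sumr -!big_split/=.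
by apply: eq_bigr => i _; rewrite !mxE; ring.
Qed.

Lemma sqnorm_axis_mx_le (R : realType) n (v w : 'cV[R]_n) (a b C : R) :
  v != 0 -> a ^+ 2 <= C -> b ^+ 2 <= C ->
  sqnorm (axis_mx v a b *m w) <= C * sqnorm w.
Proof.
move=> v0 aC bC; set p := axis_proj v *m w; set q := w - p.
have pq : p^T *m q = 0.
  have sP : (axis_proj v)^T = axis_proj v.
    by rewrite /axis_proj linearZ /= trmx_mul trmxK.
  by rewrite /p trmx_mul sP -mulmxA axis_proj_perp ?mulmx0// perp_sub_axis_proj.
have {2}-> : w = 1 *: p + 1 *: q by rewrite !scale1r /q addrC subrK.
rewrite axis_mxE -/p -/q !sqnormD_perp// expr1n !mul1r mulrDr.
by rewrite lerD// ler_wpM2r// sqnorm_ge0.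
Qed.

Lemma sqnormC_real_mulmx (R : realType) n (A : 'M[R]_n) (z : 'cV[R[i]]_n) :
  sqnormC (map_mx (real_complex R) A *m z) =
  sqnorm (A *m map_mx (@complex.Re R) z) +
  sqnorm (A *m map_mx (@complex.Im R) z).
Proof.
have ReD : {morph @complex.Re R : x y / x + y} by case=> ? ?; case.
have ImD : {morph @complex.Im R : x y / x + y} by case=> ? ?; case.
rewrite /sqnormC /sqnorm -big_split/=; apply: eq_bigr => i _; rewrite !mxE.
rewrite (big_morph _ ReD (erefl : complex.Re 0 = 0)).
rewrite (big_morph _ ImD (erefl : complex.Im 0 = 0)).
congr (_ ^+ 2 + _ ^+ 2); apply: eq_bigr => j _; rewrite !mxE.
  by case: (z j 0) => x y /=; rewrite mul0r subr0.
by case: (z j 0) => x y /=; rewrite mul0r addr0.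
Qed.

Lemma sqnormC_split (R : realType) n (z : 'cV[R[i]]_n) :
  sqnormC z =
  sqnorm (map_mx (@complex.Re R) z) + sqnorm (map_mx (@complex.Im R) z).
Proof.
rewrite /sqnormC /sqnorm -big_split/=; apply: eq_bigr => i _.
by rewrite !mxE.
Qed.

Lemma sqnormC_ge0 (R : realType) n (z : 'cV[R[i]]_n) : 0 <= sqnormC z.
Proof. by apply: sumr_ge0 => i _; rewrite addr_ge0 ?sqr_ge0. Qed.

(** A multiplier gaining a factor [(1 + |k|^2)^(-s/2)] maps H^S to H^(S+s); the
    polynomial growth of the coefficients is inherited because [0 <= s]. *)
Lemma sobolev_smoothing (R : realType) n (S s B : R)
    (f g : 'cV[int]_n -> 'cV[R[i]]_n) :
  0 <= s -> 0 <= B -> sobolev S f ->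
  (forall k,
    (1 + sqnorm (freq R k)) `^ s * sqnormC (g k) <= B * sqnormC (f k)) ->
  sobolev (S + s) g.
Proof.
move=> s0 B0 [[A [N fA]] fS] gf.
have sq0 (k : 'cV[int]_n) : 1 <= 1 + sqnorm (freq R k).
  by rewrite lerDl sqnorm_ge0.
have gf' k : sqnormC (g k) <= B * sqnormC (f k).
  apply: le_trans (gf k); rewrite -[leLHS]mul1r.
  by rewrite ler_wpM2r ?sqnormC_ge0// powR_ge1.
split.
  exists (Num.sqrt B * A), N => k; rewrite -mulrA.
  apply: le_trans (ler_wpM2l (sqrtr_ge0 B) (fA k)).
  by rewrite /enormC -sqrtrM// ler_wsqrtr.
pose F k := ((1 + sqnorm (freq R k)) `^ S * sqnormC (f k))%:E.
have F0 k : (0 <= F k)%E by rewrite lee_fin mulr_ge0 ?powR_ge0 ?sqnormC_ge0.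
apply: (@le_lt_trans _ _ (B%:E * \esum_(k in [set: 'cV[int]_n]) F k)%E).
  apply: ge_ereal_sup => _ [X [finX _] <-].
  apply: (@le_trans _ _ (\sum_(k \in X) (B%:E * F k))%E).
    apply: lee_fsum => // k _; rewrite lee_fin.
    rewrite powRD; last by rewrite (gt_eqF (lt_le_trans ltr01 (sq0 k))) implybT.
    by rewrite -mulrA [leRHS]mulrCA ler_wpM2l ?powR_ge0.
  rewrite -ge0_mule_fsumr//; apply: lee_wpmul2l; first by rewrite lee_fin.
  by apply: ereal_sup_ubound; exists X.
by rewrite lte_mul_pinfty// lee_fin.
Qed.

Lemma cos_sub1_div_le (R : realType) (x l w : R) : 0 < w -> w <= - l ->
  ((cos x - 1) / l) ^+ 2 <= 4 / w ^+ 2.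
Proof.
move=> w0 wl; rewrite expr_div_n.
have wl2 : w ^+ 2 <= l ^+ 2 by rewrite -[leRHS]sqrrN lerXn2r ?nnegrE//; lra.
have w2 : 0 < w ^+ 2 by rewrite exprn_gt0.
have c4 : (cos x - 1) ^+ 2 <= 4.
  have := cos_le1 x; have := cos_geN1 x; move: (cos x) => y y1 y2.
  have : 0 <= (3 - y) * (1 + y) by rewrite mulr_ge0//; lra.
  lra.
apply: ler_pM => //; first exact: sqr_ge0.
  by rewrite invr_ge0 sqr_ge0.
by rewrite lef_pV2 ?posrE// (lt_le_trans w2).
Qed.

Lemma peridynamic_sol_zero (R : realType) n (delta mu lam beta : R)
    (b : 'cV[int]_n -> 'cV[R[i]]_n) (t : R) :
  sqnormC (peridynamic_sol delta mu lam beta b t 0) =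
  (t ^+ 2 / 2) ^+ 2 * sqnormC (b 0).
Proof.
rewrite /peridynamic_sol eqxx /sqnormC mulr_sumr; apply: eq_bigr => i _.
rewrite mxE; case: (b 0 i 0) => x y /=; rewrite !mul0r subr0 addr0; ring.
Qed.

Lemma peridynamic_sol_le (R : realType) n (delta mu lam beta w : R)
    (b : 'cV[int]_n -> 'cV[R[i]]_n) (t : R) (k : 'cV[int]_n) :
  k != 0 -> 0 < w ->
  w <= Num.min (- lambda1 delta mu lam beta (freq R k))
               (- lambda2 delta mu beta (freq R k)) ->
  sqnormC (peridynamic_sol delta mu lam beta b t k) <=
  4 / w ^+ 2 * sqnormC (b k).
Proof.
move=> k0 w0; rewrite le_min => /andP[w1 w2].
have v0 : freq R k != 0 by rewrite freq_eq0.
rewrite /peridynamic_sol (negbTE k0) /cos_sqrt_multiplier /multiplier_fun.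
rewrite /multiplier axis_mxB1 invmx_axis_mx//; [|by rewrite lt_eqF//; lra..].
rewrite axis_mx_mul// sqnormC_real_mulmx (sqnormC_split (b k)) mulrDr.
by apply: lerD; apply: sqnorm_axis_mx_le => //; exact: cos_sub1_div_le.
Qed.

Theorem theorem25 (R : realType) (n : nat) (delta mu lam beta : R)
    (n_ge1 : (1 <= n)%N) (delta_gt0 : 0 < delta) (beta_lt : beta < n%:R + 2)
    (mu_gt0 : 0 < mu)
    (lambda1_lt0 : forall nu : 'cV[R]_n,
       nu != 0 -> lambda1 delta mu lam beta nu < 0)
    (lambda2_lt0 : forall nu : 'cV[R]_n,
       nu != 0 -> lambda2 delta mu beta nu < 0)
    (S : R) (b : 'cV[int]_n -> 'cV[R[i]]_n) (hb : sobolev S b)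
    (t : R) (t_ge0 : 0 <= t) :
  sobolev (S + Num.max 0 (beta - n%:R))
    (peridynamic_sol delta mu lam beta b t).
Proof.
have [c c0 hc] := eigenvalues_lower n_ge1 delta_gt0 beta_lt mu_gt0
  lambda1_lt0 lambda2_lt0.
set s := Num.max 0 _ in hc *; have s0 : 0 <= s by rewrite le_max lexx.
have t0 : 0 <= (t ^+ 2 / 2) ^+ 2 by exact: sqr_ge0.
have c2 : 0 <= 4 / c ^+ 2 by rewrite divr_ge0 ?sqr_ge0.
apply: (@sobolev_smoothing _ _ _ _ ((t ^+ 2 / 2) ^+ 2 + 4 / c ^+ 2) b) => //.
  exact: addr_ge0.
move=> k; rewrite mulrDl; have [->|k0] := eqVneq k 0.
  rewrite peridynamic_sol_zero (_ : freq R 0 = 0); last first.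
    by apply/eqP; rewrite freq_eq0.
  rewrite (_ : sqnorm 0 = 0); last by apply/eqP; rewrite sqnorm_eq0.
  by rewrite addr0 powR1 mul1r lerDl mulr_ge0 ?sqnormC_ge0.
have q0 : 0 < 1 + sqnorm (freq R k) by rewrite ltr_wpDr// sqnorm_ge0.
have w0 : 0 < c * (1 + sqnorm (freq R k)) `^ (s / 2).
  by rewrite mulr_gt0 ?powR_gt0.
have := peridynamic_sol_le b t k0 w0 (hc _ k0).
rewrite exprMn [_ `^ _ ^+ 2]expr2 powR_mul// -splitr => h.
have p0 : 0 < (1 + sqnorm (freq R k)) `^ s by rewrite powR_gt0.
apply: le_trans (ler_wpM2l (ltW p0) h) _.
rewrite [leLHS](_ : _ = 4 / c ^+ 2 * sqnormC (b k)).
  by rewrite lerDr mulr_ge0 ?sqnormC_ge0.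
by field; rewrite !gt_eqF.
Qed.
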